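(* Let $(\mathbf{x}_{h,k})_{k\ge 0}$ be a sequence generated by Algorithm NeMO (described in the context) applied to $\min_{\mathbf{x}\in\mathbb{R}^N} f_h(\mathbf{x})$. Let $\mathbf{x}_{h,\star}$ be the minimizer of $f_h$, $f_{h,\star}=f_h(\mathbf{x}_{h,\star})$, and $f_{h,k}=f_h(\mathbf{x}_{h,k})$. Put $$\Lambda=\min\left\{\Lambda_h,\ \frac{\rho_1\kappa^2\beta_{ls}\mu_h}{\omega^2L_h^2}\right\},\qquad \mathcal{R}(\mathbf{x}_{h,0})=\max_{\mathbf{x}_h\in\mathbb{R}^N}\{\Vert \mathbf{x}_h-\mathbf{x}_{h,\star}\Vert : f_h(\mathbf{x}_h)\le f_h(\mathbf{x}_{h,0})\}.$$ Then for all $k=0,1,2,\dots$, $$f_{h,k}-f_{h,\star}\le \frac{\mathcal{R}^2(\mathbf{x}_{h,0})}{\Lambda}\,\frac{1}{2+k}.$$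
   Context: $\Vert\cdot\Vert$ is the Euclidean norm for vectors and the induced (spectral) norm for matrices. Assumptions on $f_h$: $f_h:\mathbb{R}^N\to\mathbb{R}$ is twice differentiable and there are constants $\mu_h,L_h,M_h>0$ with $\mu_h\mathbf{I}\preccurlyeq\nabla^2 f_h(\mathbf{x})\preccurlyeq L_h\mathbf{I}$ for all $\mathbf{x}\in\mathbb{R}^N$ and $\Vert\nabla^2 f_h(\mathbf{x})-\nabla^2 f_h(\mathbf{y})\Vert\le M_h\Vert\mathbf{x}-\mathbf{y}\Vert$ for all $\mathbf{x},\mathbf{y}\in\mathbb{R}^N$. Operators: $n\le N$, $\mathbf{P}\in\mathbb{R}^{N\times n}$ has full column rank $n$, $\mathbf{R}=\mathbf{P}^T\in\mathbb{R}^{n\times N}$, and $\omega=\max\{\Vert\mathbf{P}\Vert,\Vert\mathbf{R}\Vert\}$. Algorithm NeMO. Parameters: $\kappa\in(0,\min(1,\Vert\mathbf{R}\Vert))$, $\epsilon\in(0,1)$, $\rho_1\in(0,0.5)$, $\beta_{ls}\in(0,1)$; starting point $\mathbf{x}_{h,0}\in\mathbb{R}^N$. Write $\nabla f_{h,k}=\nabla f_h(\mathbf{x}_{h,k})$, $\nabla^2 f_{h,k}=\nabla^2 f_h(\mathbf{x}_{h,k})$. For $k=0,1,2,\dots$: (1) If $\Vert\mathbf{R}\nabla f_{h,k}\Vert>\kappa\Vert\nabla f_{h,k}\Vert$ and $\Vert\mathbf{R}\nabla f_{h,k}\Vert>\epsilon$, take the coarse correction step $\mathbf{d}=\hat{\mathbf{d}}_{h,k}=-\mathbf{P}[\mathbf{R}\nabla^2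 f_{h,k}\mathbf{P}]^{-1}\mathbf{R}\nabla f_{h,k}$. Otherwise take a fine correction step $\mathbf{d}=\mathbf{d}_{h,k}=-\mathbf{Q}^{-1}\nabla f_{h,k}$, where $\mathbf{Q}\in\mathbb{R}^{N\times N}$ is positive definite (it may depend on $k$). (2) Find the smallest $q\in\{0,1,2,\dots\}$ such that $\alpha_{h,k}=\beta_{ls}^q$ satisfies $f_h(\mathbf{x}_{h,k}+\alpha_{h,k}\mathbf{d})\le f_h(\mathbf{x}_{h,k})+\rho_1\alpha_{h,k}\nabla f_{h,k}^T\mathbf{d}$. (3) Set $\mathbf{x}_{h,k+1}=\mathbf{x}_{h,k}+\alpha_{h,k}\mathbf{d}$. Assumption on fine correction steps: there are constants $\nu_h,\zeta_h>0$ such that every fine correction step satisfies $\Vert\mathbf{d}_{h,k}\Vert\le\nu_h\Vert\nabla f_{h,k}\Vert$ and $-\nabla f_{h,k}^T\mathbf{d}_{h,k}\ge\zeta_h\Vert\nabla f_{h,k}\Vert^2$; consequently there is a constant $\Lambda_h>0$ such that $f_h(\mathbf{x}_{h,k})-f_h(\mathbf{x}_{h,k+1})\ge\Lambda_h\Vert\nabla f_{h,k}\Vert^2$ whenever iteration $k$ uses a fine correction step; $\Lambda_h$ denotes such a constant. *)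

(* Defs.v *)
From HB Require Import structures.
From mathcomp Require Import all_boot all_order all_algebra.
From mathcomp Require Import all_classical all_reals all_analysis.

Set Implicit Arguments.
Unset Strict Implicit.
Unset Printing Implicit Defensive.

Import Order.TTheory GRing.Theory Num.Theory.
Import numFieldNormedType.Exports.

Local Open Scope classical_set_scope.
Local Open Scope ring_scope.

Definition dotv (R : realType) (N : nat) (u v : 'cV[R]_N) : R :=
  (u^T *m v) 0 0.

(* The library norm on ['cV[R]_N] is the sup norm: it only serves to define
   differentiability, which does not depend on the choice of the norm. *)
Definition enorm (R : realType) (N : nat) (v : 'cV[R]_N) : R :=
  Num.sqrt (dotv v v).

Definition opnorm (R : realType) (m n : nat) (A : 'M[R]_(m, n)) : R :=
  sup [set enorm (A *m v) | v in [set v : 'cV[R]_n | enorm v <= 1]].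

Definition possemidef (R : realType) (N : nat) (A : 'M[R]_N) : Prop :=
  A^T = A /\ forall v : 'cV[R]_N, 0 <= dotv v (A *m v).

Definition posdef (R : realType) (N : nat) (A : 'M[R]_N) : Prop :=
  A^T = A /\ forall v : 'cV[R]_N, v != 0 -> 0 < dotv v (A *m v).

Definition loewner_le (R : realType) (N : nat) (A B : 'M[R]_N) : Prop :=
  possemidef (B - A).

Definition basisv (R : realType) (N : nat) (i : 'I_N) : 'cV[R]_N :=
  delta_mx i 0.

Definition gradient (R : realType) (N : nat) (f : 'cV[R]_N -> R)
    (x : 'cV[R]_N) : 'cV[R]_N :=
  \col_i 'D_(basisv R i) f x.

Definition hessian (R : realType) (N : nat) (f : 'cV[R]_N -> R)
    (x : 'cV[R]_N) : 'M[R]_N :=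
  \matrix_(i, j) 'D_(basisv R i) ('D_(basisv R j) f) x.

Definition twice_differentiable (R : realType) (N : nat)
    (f : 'cV[R]_N -> R) : Prop :=
  (forall x, differentiable f x) /\ (forall x, differentiable (gradient f) x).

(* [0] is a junk value for sets without a greatest element. *)
Definition set_max (R : realType) (S : set R) : R :=
  xget 0 (S `&` ubound S).

Definition level_radius (R : realType) (N : nat) (f : 'cV[R]_N -> R)
    (xstar x0 : 'cV[R]_N) : R :=
  set_max [set enorm (y - xstar) | y in [set y | f y <= f x0]].

Definition coarse_step_cond (R : realType) (N n : nat) (f : 'cV[R]_N -> R)
    (P : 'M[R]_(N, n)) (kappa eps : R) (x : 'cV[R]_N) : Prop :=
  kappa * enorm (gradient f x) < enorm (P^T *m gradient f x) /\
  eps < enorm (P^T *m gradient f x).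

Definition coarse_dir (R : realType) (N n : nat) (f : 'cV[R]_N -> R)
    (P : 'M[R]_(N, n)) (x : 'cV[R]_N) : 'cV[R]_N :=
  - (P *m invmx (P^T *m hessian f x *m P) *m (P^T *m gradient f x)).

Definition fine_dir (R : realType) (N : nat) (f : 'cV[R]_N -> R)
    (Q : 'M[R]_N) (x : 'cV[R]_N) : 'cV[R]_N :=
  - (invmx Q *m gradient f x).

Definition armijo (R : realType) (N : nat) (f : 'cV[R]_N -> R) (rho1 : R)
    (x d : 'cV[R]_N) (alpha : R) : Prop :=
  f (x + alpha *: d) <= f x + rho1 * alpha * dotv (gradient f x) d.

(* [x k], [d k] and [beta ^+ q k] are the iterate, the search direction and the
   step length of iteration [k]; [Q k] only matters when iteration [k] is a
   fine correction step. *)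
Record nemo_run (R : realType) (N n : nat) (f : 'cV[R]_N -> R)
    (P : 'M[R]_(N, n)) (kappa eps rho1 beta : R) (x0 : 'cV[R]_N)
    (x d : nat -> 'cV[R]_N) (Q : nat -> 'M[R]_N) (q : nat -> nat) : Prop :=
  NemoRun {
    nemo_start : x 0%N = x0;
    nemo_coarse : forall k, coarse_step_cond f P kappa eps (x k) ->
      d k = coarse_dir f P (x k);
    nemo_fine : forall k, ~ coarse_step_cond f P kappa eps (x k) ->
      posdef (Q k) /\ d k = fine_dir f (Q k) (x k);
    nemo_armijo : forall k, armijo f rho1 (x k) (d k) (beta ^+ q k);
    nemo_smallest : forall k j, armijo f rho1 (x k) (d k) (beta ^+ j) ->
      (q k <= j)%N;
    nemo_update : forall k, x k.+1 = x k + beta ^+ q k *: d k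
  }.

(* Main.v *)
(* Every iteration decreases f by at least Lambda |grad f|^2, and convexity
   gives f(x_k) - f* <= |grad f(x_k)| rad on the initial level set, so
   delta_k := f(x_k) - f* satisfies
   (Lambda / rad^2) delta_k^2 <= delta_k - delta_{k+1}, which yields the 1/k
   rate. The shift by 2 comes from delta_0 <= (L / 2) rad^2 together with
   Lambda <= 1 / (2 L), the latter because rho1 beta < 1/2, kappa < omega and
   mu <= L.

   For a coarse step, let lam := - grad f . d. Then mu |d|^2 <= lam, so Armijo
   holds for all steps below mu / L and backtracking stops at a step of at
   least beta mu / L; moreover
   lam >= |P^T grad f|^2 / (L omega^2) because P^T H P <= L omega^2. *)
Require Import Defs.
From HB Require Import structures.
From mathcomp Require Import all_boot all_order all_algebra.
From mathcomp Require Import all_classical all_reals all_analysis.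
From mathcomp Require Import ring lra.

Import Order.TTheory GRing.Theory Num.Theory.
Import numFieldNormedType.Exports.
Local Open Scope ring_scope.

(** * Euclidean inner product, norm and spectral norm *)

Section Dot.
Context {R : realType}.

Lemma dotvE {N : nat} (u v : 'cV[R]_N) : dotv u v = \sum_i u i 0 * v i 0.
Proof. by rewrite /dotv mxE; apply: eq_bigr => i _; rewrite mxE. Qed.

Lemma dotvC {N : nat} (u v : 'cV[R]_N) : dotv u v = dotv v u.
Proof. by rewrite !dotvE; apply: eq_bigr => i _; rewrite mulrC. Qed.

Lemma dotvDr {N : nat} (u v w : 'cV[R]_N) :
  dotv u (v + w) = dotv u v + dotv u w.
Proof. by rewrite /dotv mulmxDr mxE. Qed.

Lemma dotvZr {N : nat} (a : R) (u v : 'cV[R]_N) :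
  dotv u (a *: v) = a * dotv u v.
Proof. by rewrite /dotv -scalemxAr mxE. Qed.

Lemma dotvNr {N : nat} (u v : 'cV[R]_N) : dotv u (- v) = - dotv u v.
Proof. by rewrite -scaleN1r dotvZr mulN1r. Qed.

Lemma dotvDl {N : nat} (u v w : 'cV[R]_N) :
  dotv (u + v) w = dotv u w + dotv v w.
Proof. by rewrite !(dotvC _ w) dotvDr. Qed.

Lemma dotvZl {N : nat} (a : R) (u v : 'cV[R]_N) :
  dotv (a *: u) v = a * dotv u v.
Proof. by rewrite !(dotvC _ v) dotvZr. Qed.

Lemma dotvNl {N : nat} (u v : 'cV[R]_N) : dotv (- u) v = - dotv u v.
Proof. by rewrite !(dotvC _ v) dotvNr. Qed.

Lemma dotv_mulmx {m n : nat} (u : 'cV[R]_m) (A : 'M[R]_(m, n)) (v : 'cV[R]_n) :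
  dotv u (A *m v) = dotv (A^T *m u) v.
Proof. by rewrite /dotv trmx_mul trmxK mulmxA. Qed.

Lemma dotv_ge0 {N : nat} (u : 'cV[R]_N) : 0 <= dotv u u.
Proof. by rewrite dotvE sumr_ge0// => i _; rewrite -expr2 sqr_ge0. Qed.

Lemma dotv_eq0 {N : nat} (u : 'cV[R]_N) : (dotv u u == 0) = (u == 0).
Proof.
apply/idP/eqP => [|->]; last by rewrite /dotv mulmx0 mxE.
rewrite dotvE psumr_eq0 => [/allP u0|i _]; last by rewrite -expr2 sqr_ge0.
apply/colP => i; rewrite mxE; apply/eqP.
by have := u0 i (mem_index_enum _); rewrite mulf_eq0 orbb.
Qed.

Lemma sqr_enorm {N : nat} (u : 'cV[R]_N) : enorm u ^+ 2 = dotv u u.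
Proof. by rewrite sqr_sqrtr// dotv_ge0. Qed.

Lemma enorm_ge0 {N : nat} (u : 'cV[R]_N) : 0 <= enorm u.
Proof. exact: sqrtr_ge0. Qed.

Lemma enorm_eq0 {N : nat} (u : 'cV[R]_N) : (enorm u == 0) = (u == 0).
Proof. by rewrite -dotv_eq0 -sqr_enorm sqrf_eq0. Qed.

Lemma enormZ {N : nat} (a : R) (u : 'cV[R]_N) : enorm (a *: u) = `|a| * enorm u.
Proof.
by rewrite /enorm dotvZl dotvZr mulrA -expr2 sqrtrM ?sqr_ge0// sqrtr_sqr.
Qed.

(** The squared length of [dotv v v *: u - dotv u v *: v] is [dotv v v] times the gap between the
    two sides. *)
Lemma dotv_cauchy_schwarz {N : nat} (u v : 'cV[R]_N) :
  dotv u v ^+ 2 <= dotv u u * dotv v v.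
Proof.
have [->|v0] := eqVneq v 0.
  by rewrite /dotv !mulmx0 !mxE expr0n mulr0.
have vv : 0 < dotv v v by rewrite lt_def dotv_eq0 v0 dotv_ge0.
have := dotv_ge0 (dotv v v *: u - dotv u v *: v).
rewrite !(dotvDl, dotvDr, dotvNl, dotvNr, dotvZl, dotvZr) (dotvC v u).
rewrite (_ : _ + _ =
  dotv v v * (dotv u u * dotv v v - dotv u v ^+ 2)); last by ring.
by rewrite pmulr_rge0// subr_ge0.
Qed.

Lemma dotv_le_enorm {N : nat} (u v : 'cV[R]_N) :
  dotv u v <= enorm u * enorm v.
Proof.
rewrite (le_trans (ler_norm _))// -(ler_pXn2r (n := 2)) ?nnegrE//; last first.
  by rewrite mulr_ge0 ?enorm_ge0.
by rewrite exprMn !sqr_enorm real_normK ?num_real// dotv_cauchy_schwarz.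
Qed.

Lemma enorm_mulmx_le {m n : nat} (A : 'M[R]_(m, n)) (v : 'cV[R]_n) :
  enorm (A *m v) <= opnorm A * enorm v.
Proof.
have sumA0 : 0 <= \sum_i dotv (row i A)^T (row i A)^T.
  by apply: sumr_ge0 => i _; exact: dotv_ge0.
pose S := [set enorm (A *m v) | v in [set v : 'cV[R]_n | enorm v <= 1]]%classic.
have ubS : has_ubound S.
  (* The witness is the Frobenius norm of [A]: Cauchy-Schwarz bounds each coordinate of [A *m w] by
     the length of a row. Without an upper bound the [sup] in [opnorm] would be a default value. *)
  exists (Num.sqrt (\sum_i dotv (row i A)^T (row i A)^T)) => _ [w /= w1 <-].
  rewrite ler_sqrt//; rewrite dotvE; apply: ler_sum => i _.
  have -> : (A *m w) i 0 = dotv (row i A)^T w.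
    by rewrite /dotv trmxK -row_mul [RHS]mxE.
  rewrite -expr2 (le_trans (dotv_cauchy_schwarz _ _))//.
  by rewrite ler_piMr ?dotv_ge0// -sqr_enorm expr_le1// enorm_ge0.
have [->|v0] := eqVneq v 0.
  have e0 k : enorm (0 : 'cV[R]_k) = 0 by apply/eqP; rewrite enorm_eq0.
  by rewrite mulmx0 !e0 mulr0.
have ev : 0 < enorm v by rewrite lt_def enorm_eq0 v0 enorm_ge0.
rewrite -ler_pdivrMr// mulrC.
apply: (ub_le_sup ubS); exists ((enorm v)^-1 *: v) => /=.
  by rewrite enormZ gtr0_norm ?invr_gt0// mulVf// gt_eqF.
by rewrite -scalemxAr enormZ gtr0_norm ?invr_gt0.
Qed.

Lemma opnorm_ge0 {m n : nat} (A : 'M[R]_(m, n)) : 0 <= opnorm A.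
Proof.
rewrite /opnorm; set S := (X in sup X).
have S0 : S 0.
  exists (0 : 'cV[R]_n); last by apply/eqP; rewrite enorm_eq0 mulmx0.
  by rewrite /= (_ : enorm _ = 0)//; apply/eqP; rewrite enorm_eq0.
(* When there is no supremum, [sup] returns 0, which also satisfies the claim. *)
have [ubS|/sup_out->//] := pselect (has_sup S).
by apply: ub_le_sup => //; case: ubS.
Qed.

(** Evaluate [H <= L] at [P *m w], then use |P w| <= om |w|. This is the upper bound on the Galerkin
    matrix used for coarse steps. *)
Lemma dotv_gram_le {N n : nat} (H : 'M[R]_N) (P : 'M[R]_(N, n)) (L om : R)
    (w : 'cV[R]_n) : 0 <= L ->
  loewner_le H L%:M -> opnorm P <= om ->
  dotv w (P^T *m H *m P *m w) <= L * om ^+ 2 * dotv w w.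
Proof.
move=> L0 [_ HL] Pom.
have -> : dotv w (P^T *m H *m P *m w) = dotv (P *m w) (H *m (P *m w)).
  by rewrite /dotv trmx_mul !mulmxA.
have := HL (P *m w); rewrite mulmxBl dotvDr dotvNr subr_ge0 => /le_trans; apply.
rewrite mul_scalar_mx dotvZr -mulrA ler_wpM2l// -!sqr_enorm -exprMn.
rewrite ler_pXn2r ?nnegrE ?mulr_ge0 ?enorm_ge0//.
  by rewrite (le_trans (enorm_mulmx_le _ _))// ler_wpM2r// enorm_ge0.
exact: le_trans (opnorm_ge0 P) Pom.
Qed.

End Dot.

(** * Second-order bounds along lines *)

Section Taylor.
Context {R : realType}.

(** With the parabola subtracted, the claim becomes psi(0) <= psi(1). The mean value theorem turns
    this into psi'(c) >= 0, and a second application, to [dphi] on [0, c], gives dphi(c) - dphi(0)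
    >= m c. *)
Lemma taylor2_ge (phi dphi ddphi : R -> R) (m : R) :
  (forall t : R, is_derive t (1 : R) phi (dphi t)) ->
  (forall t : R, is_derive t (1 : R) dphi (ddphi t)) ->
  (forall t, m <= ddphi t) ->
  phi 0 + dphi 0 + m / 2 <= phi 1.
Proof.
move=> phiD dphiD mdd.
have contD (g dg : R -> R) a b :
    (forall t : R, is_derive t (1 : R) g (dg t)) ->
    {within `[a, b], continuous g}%classic.
  move=> gD; apply: continuous_subspaceT => t.
  by apply/differentiable_continuous/derivable1_diffP; have [] := gD t.
pose psi t := phi t - (dphi 0 * t + m / 2 * t ^+ 2).
have psiD (t : R) : is_derive t (1 : R) psi (dphi t - dphi 0 - m * t).
  have phiDt := phiD t.
  apply: is_derive_eq; rewrite /GRing.scale /=; by field.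

have psiC := contD _ _ 0 1 psiD.
have [c] := MVT ltr01 (fun t _ => psiD t) psiC.
rewrite in_itv/= => /andP[c0 c1].
have dphiC := contD _ _ 0 c dphiD.
have [c'] := MVT c0 (fun t _ => dphiD t) dphiC.
move=> _ e; have := mdd c'; rewrite -(ler_pM2r c0) => mc.
rewrite /psi e; nra.
Qed.

Context {N : nat}.
Implicit Types (f : 'cV[R]_N -> R) (x v : 'cV[R]_N).

Lemma deriv_gradient f x v : differentiable f x ->
  'D_v f x = dotv (gradient f x) v.
Proof.
move=> fx; rewrite deriveE//.
have {1}-> : v = \sum_i v i 0 *: basisv R i.
  by rewrite [LHS]matrix_sum_delta; apply: eq_bigr => i _; rewrite big_ord1.
rewrite linear_sum dotvE; apply: eq_bigr => i _.
by rewrite linearZ/= mxE deriveE// mulrC.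
Qed.

Lemma is_derive_line f x v (t : R) : differentiable f (x + t *: v) ->
  is_derive t (1 : R) (fun t => f (x + t *: v)) ('D_v f (x + t *: v)).
Proof.
move=> fx; pose l (t : R) := x + t *: v.
have lD : is_diff t l (fun s => s *: v).
  apply: (is_diff_eq (is_diffD (is_diff_cst x t) (is_diff_scalel t v))).
  by apply/funext => s; rewrite !fctE add0r.
have flD := is_diff_comp lD (differentiableP fx).
apply: DeriveDef; first by apply/derivable1_diffP; case: flD.
by rewrite deriveE; [rewrite diff_val deriveE//= scale1r|case: flD].
Qed.

Lemma twice_differentiable_coord f x i : twice_differentiable f ->
  differentiable (fun y => gradient f y i 0) x.
Proof.
move=> [_ gf].
exact: (differentiable_comp (gf x) (differentiable_coord (gradient f x) i 0)).
Qed.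

Lemma is_derive_gradient_line f x v (t : R) : twice_differentiable f ->
  is_derive t (1 : R) (fun t => dotv (gradient f (x + t *: v)) v)
    (dotv v (hessian f (x + t *: v) *m v)).
Proof.
move=> f2.
pose g i (t : R) : R := v i 0 * gradient f (x + t *: v) i 0.
have -> : (fun t => dotv (gradient f (x + t *: v)) v) = \sum_i g i.
  apply/funext => s; rewrite fct_sumE dotvE.
  by apply: eq_bigr => i _; rewrite mulrC.
have gD i : is_derive t (1 : R) (g i)
    (v i 0 * \sum_j hessian f (x + t *: v) j i * v j 0).
  have fi := twice_differentiable_coord f (x + t *: v) i f2.
  apply: (is_derive_eq (is_deriveZ _ (is_derive_line _ _ _ _ fi))).
  rewrite /GRing.scale/= deriv_gradient// dotvE; congr (_ * _).
  apply: eq_bigr => j _; rewrite !mxE; congr (_ * _).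
  congr ('D_(basisv R j) _ _).
  by apply/funext => y; rewrite mxE.
apply: (is_derive_eq (is_derive_sum gD)).
rewrite dotvE; under [RHS]eq_bigr do rewrite mxE mulr_sumr.
(* [hessian] puts the outer derivative on the row index, so differentiating coordinate [i] of the
   gradient reads column [i]; swapping the sums restores the quadratic form. *)
rewrite exchange_big/=; apply: eq_bigr => i _; rewrite mulr_sumr.
by apply: eq_bigr => j _; ring.
Qed.

Lemma quadratic_lower_bound f (mu : R) x v : twice_differentiable f ->
  (forall y, loewner_le mu%:M (hessian f y)) ->
  f x + dotv (gradient f x) v + mu / 2 * dotv v v <= f (x + v).
Proof.
move=> f2 Hmu.
have H t : mu * dotv v v <= dotv v (hessian f (x + t *: v) *m v).
  have [_ /(_ v)] := Hmu (x + t *: v).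
  by rewrite mulmxBl dotvDr dotvNr mul_scalar_mx dotvZr subr_ge0.
have D' (t : R) : is_derive t (1 : R) (fun t => f (x + t *: v))
    (dotv (gradient f (x + t *: v)) v).
  by rewrite -deriv_gradient; [exact: is_derive_line (f2.1 _)|exact: f2.1].
have := taylor2_ge _ _ _ _ D' (fun t => is_derive_gradient_line f x v t f2) H.
by rewrite scale0r scale1r addr0 mulrAC.
Qed.

(** The lower Taylor bound is applied to the negative of [f] on the line from [x] to [x + v]. *)
Lemma quadratic_upper_bound f (L : R) x v : twice_differentiable f ->
  (forall y, loewner_le (hessian f y) L%:M) ->
  f (x + v) <= f x + dotv (gradient f x) v + L / 2 * dotv v v.
Proof.
move=> f2 HL.
have H t : - (L * dotv v v) <= - dotv v (hessian f (x + t *: v) *m v).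
  have [_ /(_ v)] := HL (x + t *: v).
  by rewrite mulmxBl dotvDr dotvNr mul_scalar_mx dotvZr subr_ge0 lerN2.
have D' (t : R) : is_derive t (1 : R) (fun t => f (x + t *: v))
    (dotv (gradient f (x + t *: v)) v).
  by rewrite -deriv_gradient; [exact: is_derive_line (f2.1 _)|exact: f2.1].
have := taylor2_ge _ _ _ _ (fun t => is_deriveN (D' t))
  (fun t => is_deriveN (is_derive_gradient_line f x v t f2)) H.
rewrite !fctE scale0r scale1r addr0; lra.
Qed.

End Taylor.

(** * Compact level sets and attainment of the level radius *)

Section Compactness.
Local Open Scope classical_set_scope.
Context {R : realType} {N : nat}.
Implicit Types (f : 'cV[R]_N -> R) (x y v : 'cV[R]_N).

Lemma enorm_continuous (a : 'cV[R]_N) :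
  continuous (fun y => enorm (y - a) : R).
Proof.
move=> y; apply: (continuous_comp (f := fun y => dotv (y - a) (y - a))).
  have -> : (fun y => dotv (y - a) (y - a)) =
      (fun y => \sum_i (y i 0 - a i 0) * (y i 0 - a i 0)).
    by apply/funext => z; rewrite dotvE; apply: eq_bigr => i _; rewrite !mxE.
  apply: (@cvg_big _ _ _ _ _ add_continuous _ (nbhs y)) => i _.
  have coord : (fun z : 'cV[R]_N => z i 0 - a i 0) @ nbhs y --> y i 0 - a i 0.
    by apply: cvgB; [exact: (@coord_continuous R N 1 i 0 y)|exact: cvg_cst].
  exact: (cvgM coord coord).
exact: sqrt_continuous.
Qed.

(** Each coordinate is bounded by the Euclidean norm, so [A] is a closed subset of a box. The box is
    a compact product of segments for row vectors, carried over by continuous transposition. *)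
Lemma bounded_closed_compact_cV (A : set 'cV[R]_N) (a : 'cV[R]_N) (r : R) :
  (forall y, A y -> enorm (y - a) <= r) -> closed A -> compact A.
Proof.
move=> Ar clA.
pose K := [set v : 'rV[R]_N |
  forall i, `[a i 0 - r, a i 0 + r]%classic (v ord0 i)].
have cK : compact K.
  by apply: (@rV_compact _ _ (fun i => `[a i 0 - r, a i 0 + r]%classic)) => i;
    exact: segment_compact.
have trC : continuous (@trmx R 1 N).
  move=> v B /nbhs_ballP[e /= e0 eB]; apply/nbhs_ballP; exists e => // w [_ vw].
  by apply: eB; split=> // i j; rewrite !mxE; exact: vw.
apply: (subclosed_compact clA (continuous_compact _ cK)).
  exact: continuous_subspaceT trC.
move=> y /Ar yr; exists y^T; last by rewrite trmxK.
move=> i; rewrite /= in_itv/= mxE -ler_distl (le_trans _ yr)//.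
rewrite -(ler_pXn2r (n := 2)) ?nnegrE ?enorm_ge0// sqr_enorm.
rewrite real_normK ?num_real// dotvE (bigD1 i)//= !mxE -expr2 lerDl.
by apply: sumr_ge0 => j _; rewrite -expr2 sqr_ge0.
Qed.

Lemma set_max_ub (S : set R) (c : R) :
  S c -> ubound S c -> ubound S (set_max S).
Proof.
move=> Sc cS; rewrite /set_max.
by have [] := @xgetPex _ 0 (S `&` ubound S) (ex_intro _ c (conj Sc cS)).
Qed.

(** Strong convexity makes the level set compact, so the distance to [xstar] attains a maximum on it
    and [set_max] is that maximum, not its default 0. *)
Lemma level_radius_ge f (xstar x0 y : 'cV[R]_N) (mu : R) :
  twice_differentiable f -> 0 < mu ->
  (forall y, loewner_le mu%:M (hessian f y)) ->
  gradient f xstar = 0 ->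
  f y <= f x0 -> enorm (y - xstar) <= level_radius f xstar x0.
Proof.
move=> f2 mu0 Hmu gx yx0.
pose A := [set y | f y <= f x0].
have fC : continuous f by move=> z; exact/differentiable_continuous/f2.1.
have clA : closed A.
  exact: (preimage_closed (fun z _ => fC z) (@closed_le R (f x0))).
have cA : compact A.
  (* The radius comes from quadratic growth at the stationary point: (mu / 2) |z - xstar|^2 <= f z -
     f xstar <= f x0 - f xstar. *)
  apply: (@bounded_closed_compact_cV A xstar
    (Num.sqrt (2 / mu * (f x0 - f xstar)))) => // z zA.
  have := quadratic_lower_bound f mu xstar (z - xstar) f2 Hmu.
  (* Writing the zero gradient as [0 *: 0] lets [dotvZr] remove the linear term. *)
  rewrite gx (dotvC 0) -(scale0r 0) dotvZr mul0r addr0 subrKC => lb.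
  have zx0 := le_trans lb zA.
  by rewrite ler_wsqrtr// mulrAC ler_pdivlMr//; lra.
have [c cA' cmax] := compact_EVT_max (ex_intro _ y yx0) cA
  (continuous_subspaceT (enorm_continuous xstar)).
apply: (@set_max_ub _ (enorm (c - xstar))); last by exists y.
  by exists c => //; exact: set_mem.
by move=> _ [z /= zA <-]; exact/cmax/mem_set.
Qed.

End Compactness.

(** This excludes dimension zero, where the Loewner bounds hold for all [mu] and [L] and do not give
    [mu <= L]. *)
Lemma opnorm_gt0_neq0 {R : realType} {m n : nat} (A : 'M[R]_(m, n)) :
  0 < opnorm A -> exists v : 'cV[R]_n, v != 0.
Proof.
have e0 k : enorm (0 : 'cV[R]_k) = 0 by apply/eqP; rewrite enorm_eq0.
move=> /sup_gt[|_ [v _ <-] Av].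
  by exists (enorm (A *m 0)), 0 => //=; rewrite e0.
by exists v; apply: contraTneq Av => ->; rewrite mulmx0 e0 ltxx.
Qed.

Lemma loewner_le_scalar {R : realType} {N : nat} (a b : R)
    (H : 'M[R]_N) (v : 'cV[R]_N) :
  v != 0 -> loewner_le a%:M H -> loewner_le H b%:M -> a <= b.
Proof.
move=> v0 [_ /(_ v) aH] [_ /(_ v) Hb].
have vv : 0 < dotv v v by rewrite lt_def dotv_eq0 v0 dotv_ge0.
rewrite -(ler_pM2r vv); move: aH Hb.
rewrite !mulmxBl !dotvDr !dotvNr !mul_scalar_mx !dotvZr !subr_ge0.
exact: le_trans.
Qed.

(** * Decrease of the objective in one iteration *)

Section Descent.
Context {R : realType} {N : nat}.
Implicit Types (f : 'cV[R]_N -> R) (x y v : 'cV[R]_N).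

(** The step -(1/L) grad f minimizes the quadratic upper bound and gains |grad f|^2 / (2 L), which
    cannot exceed f x - f xstar. *)
Lemma gradient_sqr_le f (L : R) x xstar : twice_differentiable f -> 0 < L ->
  (forall y, loewner_le (hessian f y) L%:M) -> (forall y, f xstar <= f y) ->
  dotv (gradient f x) (gradient f x) <= 2 * L * (f x - f xstar).
Proof.
move=> f2 L0 HL xmin.
have := quadratic_upper_bound f L x (- L^-1 *: gradient f x) f2 HL.
rewrite !(dotvZl, dotvZr) => ub; have := le_trans (xmin _) ub.
set G := dotv _ _.
have -> : L / 2 * (- L^-1 * (- L^-1 * G)) = G / (2 * L).
  by field; rewrite gt_eqF.
have -> : - L^-1 * G = - (2 * (G / (2 * L))) by field; rewrite gt_eqF.
move=> h; have : G / (2 * L) <= f x - f xstar by lra.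
by rewrite ler_pdivrMr ?mulr_gt0// mulrC.
Qed.

Lemma gradient_min f (L : R) xstar : twice_differentiable f -> 0 < L ->
  (forall y, loewner_le (hessian f y) L%:M) -> (forall y, f xstar <= f y) ->
  gradient f xstar = 0.
Proof.
move=> f2 L0 HL xmin; apply/eqP; rewrite -dotv_eq0 eq_le dotv_ge0 andbT.
by have := gradient_sqr_le f L xstar xstar f2 L0 HL xmin; rewrite subrr mulr0.
Qed.

Lemma backtracking_step f (rho1 beta L mu lam : R) x (d : 'cV[R]_N) (q : nat) :
  twice_differentiable f -> (forall y, loewner_le (hessian f y) L%:M) ->
  0 < mu -> mu <= L -> 0 < rho1 -> rho1 < 2^-1 -> 0 < beta -> beta < 1 ->
  - dotv (gradient f x) d = lam -> mu * dotv d d <= lam ->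
  armijo f rho1 x d (beta ^+ q) ->
  (forall j, armijo f rho1 x d (beta ^+ j) -> (q <= j)%N) ->
  rho1 * (beta * (mu / L)) * lam <= f x - f (x + beta ^+ q *: d).
Proof.
move=> f2 HL mu0 muL rho0 rho2 b0 b1 gd dd armq minq.
have L0 : 0 < L := lt_le_trans mu0 muL.
have lam0 : 0 <= lam by rewrite (le_trans _ dd)// mulr_ge0 ?dotv_ge0// ltW.
have step : beta * (mu / L) <= beta ^+ q.
  case: q minq {armq} => [|q] minq.
    have muL1 : mu / L <= 1 by rewrite ler_pdivrMr// mul1r.
    by rewrite expr0 mulr_ile1// ltW// divr_gt0.
  (* The preceding trial a = beta^q was rejected, so it is not below mu / L: there a L |d|^2 <= lam,
     so the upper bound yields a decrease of at least a lam / 2, and rho1 < 1/2 would give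
     Armijo. *)
  rewrite exprS ler_pM2l// leNgt; apply/negP => blt.
  suff /minq : armijo f rho1 x d (beta ^+ q) by rewrite ltnn.
  have a0 : 0 < beta ^+ q by rewrite exprn_gt0.
  move: a0 blt; set a := beta ^+ q => a0 blt; rewrite /armijo.
  apply: (le_trans (quadratic_upper_bound f L x (a *: d) f2 HL)).
  rewrite !(dotvZl, dotvZr).
  have -> : dotv (gradient f x) d = - lam by rewrite -gd opprK.
  have aL : a * L <= mu by rewrite -ler_pdivlMr// ltW.
  have aLD : a * L * dotv d d <= lam.
    by rewrite (le_trans _ dd)// ler_wpM2r ?dotv_ge0.
  have : a * (a * L * dotv d d) <= a * lam by rewrite ler_pM2l.
  have : rho1 * (a * lam) <= 2^-1 * (a * lam).
    by rewrite ler_wpM2r ?(ltW rho2)// mulr_ge0// ltW.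
  lra.
move: armq; rewrite /armijo.
have -> : dotv (gradient f x) d = - lam by rewrite -gd opprK.
have : rho1 * (beta * (mu / L)) * lam <= rho1 * beta ^+ q * lam.
  by rewrite ler_wpM2r// ler_pM2l.
lra.
Qed.

(** For a row [u] of the left kernel, the quadratic form of [H] vanishes at [P *m u^T]. Positivity
    forces [P *m u^T = 0], and full column rank forces [u = 0]. *)
Lemma galerkin_unit {n : nat} (H : 'M[R]_N) (P : 'M[R]_(N, n)) (mu : R) :
  0 < mu -> loewner_le mu%:M H -> \rank P = n -> P^T *m H *m P \in unitmx.
Proof.
move=> mu0 [_ Hmu] rkP; rewrite -row_free_unit -kermx_eq0; apply/eqP.
apply/row_matrixP => i; rewrite row0.
set u := row i _.
have /sub_kermxP uA : (u <= kermx (P^T *m H *m P))%MS by exact: row_sub.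
have := Hmu (P *m u^T).
rewrite mulmxBl dotvDr dotvNr subr_ge0 mul_scalar_mx dotvZr.
have -> : dotv (P *m u^T) (H *m (P *m u^T)) = 0.
  by rewrite /dotv trmx_mul trmxK !mulmxA -(mulmxA u) -(mulmxA u) uA mul0mx mxE.
rewrite pmulr_rle0// => le0.
have : P *m u^T == 0 by rewrite -dotv_eq0 eq_le le0 dotv_ge0.
rewrite -(inj_eq trmx_inj) trmx_mul trmxK trmx0 => /eqP/esym.
have rfP : row_free P^T by rewrite /row_free mxrank_tr rkP.
by rewrite -(mul0mx _ P^T) => /(row_free_inj rfP) <-.
Qed.

Lemma coarse_decrease {n : nat} f (mu L kappa eps rho1 beta om : R)
    (P : 'M[R]_(N, n)) x (d : 'cV[R]_N) (q : nat) :
  twice_differentiable f ->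
  (forall y, loewner_le mu%:M (hessian f y)) ->
  (forall y, loewner_le (hessian f y) L%:M) ->
  \rank P = n -> 0 < mu -> mu <= L -> 0 < rho1 -> rho1 < 2^-1 ->
  0 < beta -> beta < 1 -> 0 < kappa -> 0 < om -> opnorm P <= om ->
  coarse_step_cond f P kappa eps x -> d = coarse_dir f P x ->
  armijo f rho1 x d (beta ^+ q) ->
  (forall j, armijo f rho1 x d (beta ^+ j) -> (q <= j)%N) ->
  rho1 * kappa ^+ 2 * beta * mu / (om ^+ 2 * L ^+ 2) * enorm (gradient f x) ^+ 2
    <= f x - f (x + beta ^+ q *: d).
Proof.
move=> f2 Hmu HL rkP mu0 muL rho0 rho2 b0 b1 k0 om0 Pom [kg _] dE armq minq.
have L0 : 0 < L := lt_le_trans mu0 muL.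
pose A := P^T *m hessian f x *m P.
have Au : A \in unitmx := galerkin_unit (hessian f x) P mu mu0 (Hmu x) rkP.
(* [w] solves the coarse Newton system [A *m w = gc], so d = - P w and -g . d = w . gc = w^T A w. *)
pose g := gradient f x; pose gc := P^T *m g; pose w := invmx A *m gc.
have Aw : A *m w = gc by rewrite mulmxA mulmxV// mul1mx.
have dw : d = - (P *m w) by rewrite dE /w mulmxA.
(* Symmetry of the Hessian is read off the symmetric difference [L%:M - hessian f x]; below it turns
   the cross term [dotv w (A *m gc)] into [dotv gc gc]. *)
have symA : A^T = A.
  have [] := HL x; rewrite linearB/= tr_scalar_mx => /addrI/oppr_inj symH _.
  by rewrite /A !trmx_mul trmxK symH mulmxA.
pose lam := dotv w gc.
have gd : - dotv g d = lam by rewrite dw dotvNr opprK dotv_mulmx dotvC.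
have AP (v : 'cV[R]_n) :
    dotv v (A *m v) = dotv (P *m v) (hessian f x *m (P *m v)).
  by rewrite /dotv trmx_mul !mulmxA.
have dd : mu * dotv d d <= lam.
  have [_ /(_ (P *m w))] := Hmu x.
  rewrite mulmxBl dotvDr dotvNr subr_ge0 mul_scalar_mx dotvZr -AP Aw.
  by rewrite dw dotvNl dotvNr opprK.
have := backtracking_step f rho1 beta L mu lam x d q f2 HL mu0 muL rho0 rho2
  b0 b1 gd dd armq minq.
apply: le_trans.
have B0 : 0 < L * om ^+ 2 by rewrite mulr_gt0// exprn_gt0.
(* Positivity of [A] at [w - t gc] with [t = 1 / (L om^2)]. *)
have gclam : dotv gc gc <= L * om ^+ 2 * lam.
  pose t := (L * om ^+ 2)^-1.
  have [_ /(_ (P *m (w - t *: gc)))] := Hmu x.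
  rewrite mulmxBl dotvDr dotvNr subr_ge0 mul_scalar_mx dotvZr -AP => h.
  have : 0 <= dotv (w - t *: gc) (A *m (w - t *: gc)).
    by rewrite (le_trans _ h)// mulr_ge0 ?dotv_ge0// ltW.
  rewrite mulmxBr -scalemxAr Aw.
  rewrite !(dotvDl, dotvDr, dotvNl, dotvNr, dotvZl, dotvZr).
  have -> : dotv w (A *m gc) = dotv gc gc by rewrite dotv_mulmx symA Aw.
  have t0 : 0 < t by rewrite invr_gt0.
  have gram : t * dotv gc (A *m gc) <= dotv gc gc.
    by rewrite ler_pdivrMl//; exact: dotv_gram_le (ltW L0) (HL x) Pom.
  have : t * (t * dotv gc (A *m gc)) <= t * dotv gc gc by rewrite ler_pM2l.
  move=> tgram pos; rewrite -ler_pdivrMl// -/t.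
  by move: pos tgram; rewrite -/lam; lra.
have kgc : kappa ^+ 2 * dotv g g <= dotv gc gc.
  rewrite -!sqr_enorm -exprMn.
  rewrite ler_pXn2r ?nnegrE ?mulr_ge0 ?enorm_ge0 ?(ltW k0)//.
  exact: ltW kg.
rewrite sqr_enorm -/g.
(* The constant splits into the line search gain rho1 beta mu / L and the lower bound kappa^2 |g|^2
   / (L om^2) on lam, obtained from the coarse test. *)
have -> : rho1 * kappa ^+ 2 * beta * mu / (om ^+ 2 * L ^+ 2) * dotv g g =
   rho1 * (beta * (mu / L)) * (kappa ^+ 2 * dotv g g / (L * om ^+ 2)).
  by field; rewrite !gt_eqF.
rewrite ler_pM2l ?mulr_gt0 ?invr_gt0//.
by rewrite ler_pdivrMr// (le_trans kgc)// mulrC.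
Qed.

End Descent.

(** Induction on delta_k Lam (2 + k) <= r. With a = delta_k, b = delta_{k+1}, m = 2 + k, the
    hypothesis gives a b Lam m <= b r, while monotonicity and the recursion give a b Lam <= a^2 Lam
    <= r (a - b). Adding these and cancelling a closes the step. *)
Lemma sublinear_rate {R : realType} (delta : nat -> R) (Lam r : R) :
  0 < Lam -> (forall k, 0 <= delta k) ->
  (forall k, delta k.+1 <= delta k) -> delta 0%N * (2 * Lam) <= r ->
  (forall k, Lam * delta k ^+ 2 <= r * (delta k - delta k.+1)) ->
  forall k, delta k <= r / Lam * (1 / (2 + k)%:R).
Proof.
move=> Lam0 d0 dec base rec.
have main k : delta k * (Lam * (2 + k)%:R) <= r.
  elim: k => [|k IH]; first by rewrite addn0 (mulrC Lam).
  have := rec k; have := d0 k; have := d0 k.+1; have := dec k.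
  move: IH; rewrite addnS -(natr1 (2 + k)).
  move: (delta k) (delta k.+1) ((2 + k)%:R : R) (ler0n R (2 + k)).
  move=> a b m m0 IH ba b0 a0 rk.
  (* If a = 0 it cannot be cancelled, but then b = 0, and r >= 0 follows from the base bound. *)
  have [a_eq0|a_gt0] := leP a 0.
    have r0 : 0 <= r by rewrite (le_trans _ base)// mulr_ge0// mulr_ge0// ltW.
    have -> : b = 0 by lra.
    by rewrite mul0r.
  rewrite -(ler_pM2l a_gt0).
  have : b * (a * (Lam * m)) <= b * r by rewrite ler_wpM2l.
  have : Lam * a * b <= Lam * a * a by rewrite ler_wpM2l// mulr_ge0// ltW.
  by move: rk; rewrite expr2; lra.
move=> k; have h : 0 < Lam * (2 + k)%:R :> R by rewrite mulr_gt0// ltr0n.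
by rewrite mul1r -mulrA -invfM ler_pdivlMr.
Qed.

Theorem theorem3p5 (R : realType) (N n : nat) (f : 'cV[R]_N -> R)
  (mu L M : R) (P : 'M[R]_(N, n)) (kappa eps rho1 beta : R)
  (x0 xstar : 'cV[R]_N) (x d : nat -> 'cV[R]_N)
  (Q : nat -> 'M[R]_N) (q : nat -> nat) (nu zeta Lambda_h : R)
  (f_diff2 : twice_differentiable f)
  (mu_gt0 : 0 < mu) (L_gt0 : 0 < L) (M_gt0 : 0 < M)
  (hess_lb : forall y, loewner_le mu%:M (hessian f y))
  (hess_ub : forall y, loewner_le (hessian f y) L%:M)
  (hess_lip : forall y z,
     opnorm (hessian f y - hessian f z) <= M * enorm (y - z))
  (n_le_N : (n <= N)%N) (P_rank : \rank P = n)
  (kappa_gt0 : 0 < kappa) (kappa_lt : kappa < Num.min 1 (opnorm P^T))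
  (eps_gt0 : 0 < eps) (eps_lt1 : eps < 1)
  (rho1_gt0 : 0 < rho1) (rho1_lt : rho1 < 2^-1)
  (beta_gt0 : 0 < beta) (beta_lt1 : beta < 1)
  (run : nemo_run f P kappa eps rho1 beta x0 x d Q q)
  (nu_gt0 : 0 < nu) (zeta_gt0 : 0 < zeta)
  (fine_bound : forall k, ~ coarse_step_cond f P kappa eps (x k) ->
     enorm (d k) <= nu * enorm (gradient f (x k)))
  (fine_descent : forall k, ~ coarse_step_cond f P kappa eps (x k) ->
     zeta * enorm (gradient f (x k)) ^+ 2 <= - dotv (gradient f (x k)) (d k))
  (Lambda_h_gt0 : 0 < Lambda_h)
  (fine_decrease : forall k, ~ coarse_step_cond f P kappa eps (x k) ->
     Lambda_h * enorm (gradient f (x k)) ^+ 2 <= f (x k) - f (x k.+1))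
  (xstar_min : forall y, f xstar <= f y) :
  let omega := Num.max (opnorm P) (opnorm P^T) in
  let Lambda := Num.min Lambda_h
    (rho1 * kappa ^+ 2 * beta * mu / (omega ^+ 2 * L ^+ 2)) in
  forall k : nat,
    f (x k) - f xstar <=
      level_radius f xstar x0 ^+ 2 / Lambda * (1 / (2 + k)%:R).
Proof.
move=> omega Lambda.
have om_ge : opnorm P <= omega by rewrite le_max lexx.
have k_om : kappa < omega.
  by move: kappa_lt; rewrite lt_min => /andP[_ k]; rewrite lt_max k orbT.
have om0 : 0 < omega := lt_trans kappa_gt0 k_om.
have muL : mu <= L.
  (* Comparing [mu] with [L] takes a nonzero vector; 0 < kappa < [opnorm P^T] supplies one. *)
  have [v v0] : exists v : 'cV[R]_N, v != 0.
    apply: (opnorm_gt0_neq0 P^T); apply: lt_trans kappa_gt0 _.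
    by move: kappa_lt; rewrite lt_min => /andP[].
  exact: loewner_le_scalar v0 (hess_lb 0) (hess_ub 0).
have gxstar := gradient_min f L xstar f_diff2 L_gt0 hess_ub xstar_min.
pose delta k := f (x k) - f xstar.
have step k : Lambda * dotv (gradient f (x k)) (gradient f (x k))
    <= delta k - delta k.+1.
  rewrite /delta opprB addrA subrK -sqr_enorm.
  have [coarse|fine] := pselect (coarse_step_cond f P kappa eps (x k)).
    have dE := nemo_coarse run coarse.
    have := coarse_decrease f mu L kappa eps rho1 beta omega P (x k) (d k) (q k)
      f_diff2 hess_lb hess_ub P_rank mu_gt0 muL rho1_gt0 rho1_lt beta_gt0
      beta_lt1 kappa_gt0 om0 om_ge coarse dE (nemo_armijo run k)
      (fun j => nemo_smallest run (j := j)).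
    rewrite -(nemo_update run k); apply: le_trans.
    by rewrite ler_wpM2r ?exprn_ge0 ?enorm_ge0// ge_min lexx orbT.
  apply: le_trans (fine_decrease k fine).
  by rewrite ler_wpM2r ?exprn_ge0 ?enorm_ge0// ge_min lexx.
have Lam0 : 0 < Lambda.
  by rewrite lt_min Lambda_h_gt0 divr_gt0 ?mulr_gt0 ?exprn_gt0.
have dec k : delta k.+1 <= delta k.
  by rewrite -subr_ge0 (le_trans _ (step k))// mulr_ge0 ?dotv_ge0 ?ltW.
(* Monotone decrease keeps every iterate in the initial level set, so the single radius [rad] serves
   all [k]. *)
have level k : f (x k) <= f x0.
  elim: k => [|k]; first by rewrite (nemo_start run).
  by apply: le_trans; have := dec k; rewrite lerD2r.
pose rad := level_radius f xstar x0.
have radP k : enorm (x k - xstar) <= rad.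
  exact: level_radius_ge f_diff2 mu_gt0 hess_lb gxstar (level k).
have rad0 : 0 <= rad := le_trans (enorm_ge0 _) (radP 0%N).
have d0 k : 0 <= delta k by rewrite subr_ge0.
apply: (sublinear_rate delta) => // [|k].
  (* Base case of the rate: the gradient vanishes at [xstar], so the upper bound there leaves only
     (L / 2) |x_0 - xstar|^2. *)
  have := quadratic_upper_bound f L xstar (x 0%N - xstar) f_diff2 hess_ub.
  rewrite gxstar dotvC -(scale0r 0) dotvZr mul0r addr0 subrKC -sqr_enorm => ub.
  have d0L : delta 0%N <= L / 2 * rad ^+ 2.
    rewrite lerBlDl (le_trans ub)// lerD2l ler_pM2l ?divr_gt0//.
    by rewrite ler_pXn2r ?nnegrE ?enorm_ge0.
  have LL : Lambda * (2 * L) <= 1.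
    have k2 : kappa ^+ 2 <= omega ^+ 2 by rewrite ler_pXn2r ?nnegrE ?ltW.
    have rb : rho1 * beta <= 2^-1 by rewrite -[leRHS]mulr1 ler_pM ?ltW.
    have : Lambda <= rho1 * kappa ^+ 2 * beta * mu / (omega ^+ 2 * L ^+ 2).
      by rewrite ge_min lexx orbT.
    rewrite ler_pdivlMr ?mulr_gt0 ?exprn_gt0// => LamE.
    (* Multiplied by omega^2 L, the goal is twice the chain Lambda omega^2 L^2 <= rho1 beta kappa^2
       mu <= omega^2 L / 2. *)
    have oL : 0 < omega ^+ 2 * L by rewrite mulr_gt0 ?exprn_gt0.
    have : rho1 * beta * (kappa ^+ 2 * mu) <= 2^-1 * (omega ^+ 2 * L).
      have km : kappa ^+ 2 * mu <= omega ^+ 2 * L.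
        by rewrite ler_pM// ?sqr_ge0// ltW.
      by rewrite ler_pM// mulr_ge0// ?sqr_ge0// ltW.
    rewrite -(ler_pM2r oL); move: LamE; lra.
  have : rad ^+ 2 * (Lambda * (2 * L)) <= rad ^+ 2 by rewrite ler_piMr ?sqr_ge0.
  have : delta 0%N * (2 * Lambda) <= L / 2 * rad ^+ 2 * (2 * Lambda).
    by rewrite ler_wpM2r// mulr_ge0// ltW.
  have : 0 <= rad ^+ 2 * (Lambda * (2 * L)).
    by rewrite !mulr_ge0// ?sqr_ge0// ltW.
  rewrite -/rad; lra.
(* The lower bound from x_k towards [xstar], with its nonnegative quadratic term dropped, is the
   convexity inequality; Cauchy-Schwarz and [radP] finish. *)
have gd : delta k <= enorm (gradient f (x k)) * rad.
  have := quadratic_lower_bound f mu (x k) (xstar - x k) f_diff2 hess_lb.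
  rewrite subrKC => lb.
  have : dotv (gradient f (x k)) (x k - xstar) <=
      enorm (gradient f (x k)) * rad.
    by rewrite (le_trans (dotv_le_enorm _ _))// ler_wpM2l ?enorm_ge0.
  have : 0 <= mu / 2 * dotv (xstar - x k) (xstar - x k).
    by rewrite mulr_ge0 ?dotv_ge0 ?divr_ge0 ?ltW.
  by rewrite -(opprB xstar) dotvNr /delta; lra.
have := step k; rewrite -sqr_enorm => sk.
(* Squaring [gd] and multiplying by Lambda lets the decrease [sk] replace Lambda |grad f|^2, which
   is the recursion with r = rad^2. *)
have : delta k ^+ 2 <= (enorm (gradient f (x k)) * rad) ^+ 2.
  by rewrite ler_pXn2r ?nnegrE ?mulr_ge0 ?enorm_ge0.
rewrite exprMn => /(ler_wpM2l (ltW Lam0)) /le_trans; apply.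
by rewrite mulrA mulrC ler_wpM2l ?sqr_ge0.
Qed.
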